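(* For all integers $k\ge 1$, the following are equivalent for a complete multipartite graph $G$: (a) $G\in\widehat{\mathcal{C}}_k$; (b) $G\in\widehat{\mathcal{D}}_k$; (c) for some integers $b\ge a\ge 1$ and $p\ge 2$ such that $k+1=a+(p-1)b$, $$G=K_{a,\underbrace{b,\dots,b}_{p}},$$ and if $p=2$ then $a=b$.
   Context: All graphs are undirected, simple, finite and non-empty. A graph $H$ is a minor of $G$ if a graph isomorphic to $H$ can be obtained from $G$ by a sequence of edge contractions, edge deletions and vertex deletions (after a contraction, parallel edges are replaced by a single edge). $\mathcal{D}_k$ is the class of graphs $G$ such that every minor of $G$ has minimum degree at most $k$. $\mathcal{C}_k$ is the class of graphs $G$ such that every minor of $G$ has (vertex-)connectivity $\kappa$ at most $k$, where $\kappa(K_n)=n-1$. For a minor-closed class $\mathcal{X}$, $\widehat{\mathcal{X}}$ denotes its set of minimal forbidden minors: the graphs $G\notin\mathcal{X}$ such that every proper minor of $G$ is in $\mathcal{X}$. A graph is complete $c$-partite if its vertices can be $c$-coloured so that two vertices are adjacent if and only if they have distinct colours; it is complete multipartite if it is complete $c$-partite for some $c$. $K_{n_1,\dots,n_c}$ is the complete $c$-partite graph with $n_i$ vertices in the $i$-th colour class. $K_{a,b,\dots,b}$ above has one class of size $a$ and $p$ further classes of size $b$. Equality of graphs means isomorphism. *)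

(* Defs.v *)
From mathcomp Require Import all_boot.

Set Implicit Arguments.
Unset Strict Implicit.
Unset Printing Implicit Defensive.

Record sgraph := SGraph {
  vertex :> finType;
  adj : rel vertex;
  adj_sym : symmetric adj;
  adj_irrefl : irreflexive adj;
  vertex_gt0 : 0 < #|vertex| }.

Arguments adj {s}.

Definition giso (G H : sgraph) : Prop :=
  exists2 f : G -> H, bijective f & forall x y : G, adj (f x) (f y) = adj x y.

Section DeleteVertex.
Variables (G : sgraph) (v : G) (G_gt1 : 1 < #|G|).

Definition del_vertex_adj : rel {x : G | x != v} :=
  fun x y => adj (val x) (val y).

Fact del_vertex_sym : symmetric del_vertex_adj.
Proof. by move=> x y; apply: adj_sym. Qed.

Fact del_vertex_irrefl : irreflexive del_vertex_adj.
Proof. by move=> x; apply: adj_irrefl. Qed.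

Fact del_vertex_gt0 : 0 < #|{: {x : G | x != v}}|.
Proof. by rewrite card_sig cardC1 -ltnS prednK // ltnW. Qed.

Definition del_vertex : sgraph :=
  SGraph del_vertex_sym del_vertex_irrefl del_vertex_gt0.
End DeleteVertex.

Section DeleteEdge.
Variables (G : sgraph) (x y : G).

Definition del_edge_adj : rel G :=
  fun u v => adj u v && ([set u; v] != [set x; y]).

Fact del_edge_sym : symmetric del_edge_adj.
Proof. by move=> u v; rewrite /del_edge_adj adj_sym setUC. Qed.

Fact del_edge_irrefl : irreflexive del_edge_adj.
Proof. by move=> u; rewrite /del_edge_adj adj_irrefl. Qed.

Definition del_edge : sgraph :=
  SGraph del_edge_sym del_edge_irrefl (vertex_gt0 G).
End DeleteEdge.

(* In the contraction of the edge xy, the merged vertex is represented by x. *)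
Section ContractEdge.
Variables (G : sgraph) (x y : G) (xy : adj x y).

Definition contract_adj : rel {z : G | z != y} :=
  fun u v => (u != v) &&
    [|| adj (val u) (val v), (val u == x) && adj y (val v)
      | (val v == x) && adj y (val u)].

Fact contract_sym : symmetric contract_adj.
Proof.
move=> u v; rewrite /contract_adj eq_sym adj_sym; congr (_ && (_ || _)).
exact: orbC.
Qed.

Fact contract_irrefl : irreflexive contract_adj.
Proof. by move=> u; rewrite /contract_adj eqxx. Qed.

Fact contract_gt0 : 0 < #|{: {z : G | z != y}}|.
Proof.
have x_neq_y : x != y by apply: contraTneq xy => ->; rewrite adj_irrefl.
by apply/card_gt0P; exists (Sub x x_neq_y).
Qed.

Definition contract : sgraph :=
  SGraph contract_sym contract_irrefl contract_gt0.
End ContractEdge.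

Inductive reduces (G : sgraph) : sgraph -> Prop :=
| reduces_refl : reduces G G
| reduces_del_vertex (H : sgraph) (v : H) (H_gt1 : 1 < #|H|) :
    reduces G H -> reduces G (del_vertex v H_gt1)
| reduces_del_edge (H : sgraph) (x y : H) :
    adj x y -> reduces G H -> reduces G (del_edge x y)
| reduces_contract (H : sgraph) (x y : H) (xy : adj x y) :
    reduces G H -> reduces G (contract xy).

Definition minor (H G : sgraph) : Prop :=
  exists2 H' : sgraph, reduces G H' & giso H' H.

Definition proper_minor (H G : sgraph) : Prop := minor H G /\ ~ giso H G.

Definition degree (G : sgraph) (x : G) : nat := #|[set y | adj x y]|.

(* Degrees are less than #|G| and G has a vertex, so the default #|G| is never
   the value. *)
Definition min_degree (G : sgraph) : nat :=
  \big[minn/#|G|]_(x : G) degree x.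

Definition separator (G : sgraph) (S : {set G}) : bool :=
  [exists x, exists y, [&& x \notin S, y \notin S &
    ~~ connect (fun u v => [&& u \notin S, v \notin S & adj u v]) x y]].

(* A complete graph has no separator, and then the value is #|G|.-1; in any
   other graph there is a separator, and all separators are smaller than
   #|G|.-1, since at least two vertices lie outside them. *)
Definition connectivity (G : sgraph) : nat :=
  \big[minn/#|G|.-1]_(S : {set G} | separator S) #|S|.

Definition D (k : nat) (G : sgraph) : Prop :=
  forall H : sgraph, minor H G -> min_degree H <= k.

Definition C (k : nat) (G : sgraph) : Prop :=
  forall H : sgraph, minor H G -> connectivity H <= k.

Definition minimal_forbidden (X : sgraph -> Prop) (G : sgraph) : Prop :=
  ~ X G /\ forall H : sgraph, proper_minor H G -> X H.

Definition complete_partite (c : nat) (G : sgraph) : Prop :=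
  exists f : G -> 'I_c, forall x y : G, adj x y = (f x != f y).

Definition complete_multipartite (G : sgraph) : Prop :=
  exists c : nat, complete_partite c G.

(* The complete multipartite graph with class sizes ns; a vertex is a pair of
   a class index i and an element of the i-th class. *)
Section CompletePartiteGraph.
Variables (ns : seq nat) (ns_gt0 : 0 < sumn ns).

Definition K_vertex : finType := {i : 'I_(size ns) & 'I_(nth 0 ns i)}.

Definition K_adj : rel K_vertex := fun u v => tag u != tag v.

Fact K_sym : symmetric K_adj.
Proof. by move=> u v; rewrite /K_adj eq_sym. Qed.

Fact K_irrefl : irreflexive K_adj.
Proof. by move=> u; rewrite /K_adj eqxx. Qed.

Fact K_gt0 : 0 < #|K_vertex|.
Proof.
rewrite card_tagged sumnE big_map big_enum /=.
under eq_bigr do rewrite card_ord.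
by move: ns_gt0; rewrite sumnE (big_nth 0) big_mkord.
Qed.

Definition K : sgraph := SGraph K_sym K_irrefl K_gt0.
End CompletePartiteGraph.

Fact sumn_cons_nseq_gt0 (a b p : nat) : 0 < a -> 0 < sumn (a :: nseq p b).
Proof. exact: ltn_addr. Qed.

(* K_{a,b,...,b} with one class of size a and p classes of size b *)
Definition Kab (a b p : nat) (a_gt0 : 0 < a) : sgraph :=
  K (sumn_cons_nseq_gt0 b p a_gt0).

(* Main.v *)
(* In a complete multipartite graph connectivity and minimum degree agree: any
   two nonadjacent vertices have the same neighbours, so a separator contains a
   whole neighbourhood.

   If G is minimal forbidden for either class, all degrees exceed k and every
   proper minor has connectivity at most k.  Deleting a vertex v shows that v has
   a neighbour of degree k+1; deleting an edge shows that each edge has an end of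
   degree k+1, so there is at most one class that is not largest; contracting an
   edge between two largest classes leaves a complete multipartite graph and
   shows that there is a third largest class.

   Conversely, let H be a minor of K_{a,b,...,b} of minimum degree at least
   a + (p-1)b, with r fewer vertices.  At most r of its branch sets have more
   than one vertex, and each colour class contains at most b-r singleton branch
   sets.  Counting vertices of H gives (p-2) r <= min(a, b-r) - a, so r = 0
   (when p = 2, because a = b); then H is a spanning subgraph, and no edge is missing because each edge has an end
   in a class of size b, whose degree is already minimal. *)

Require Import Defs.
From mathcomp Require Import all_boot zify.

Set Implicit Arguments.
Unset Strict Implicit.
Unset Printing Implicit Defensive.

(** * Minimum degree and connectivity *)

Lemma ltn_bigminnP (I : finType) (P : pred I) (F : I -> nat) d k :
  reflect (k < d /\ forall i, P i -> k < F i)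
    (k < \big[minn/d]_(i | P i) F i).
Proof.
apply: (iffP idP) => [lt_k | [k_d k_F]]; last first.
  by apply: (big_ind (fun m => k < m)) => // m n; rewrite leq_min => -> ->.
suff H (s : seq I) : k < \big[minn/d]_(i <- s | P i) F i ->
    k < d /\ forall i, i \in s -> P i -> k < F i.
  by case/H: lt_k => k_d k_F; split=> // i; apply/k_F/mem_index_enum.
elim: s => [|j s IHs]; first by rewrite big_nil.
rewrite big_cons; case: ifP => Pj; last first.
  case/IHs => k_d k_F; split=> // i /[!inE] /predU1P[->|]; last exact: k_F.
  by rewrite Pj.
rewrite leq_min => /andP[k_Fj /IHs[k_d k_F]]; split=> // i.
by rewrite inE => /predU1P[->|]; last exact: k_F.
Qed.

Lemma degree_ltn (G : sgraph) (x : G) : degree x < #|G|.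
Proof.
rewrite -cardsT; apply/proper_card/properP; split; first exact: subsetT.
by exists x; rewrite ?inE ?adj_irrefl.
Qed.

Lemma min_degree_gtP (G : sgraph) k :
  reflect (forall x : G, k < degree x) (k < min_degree G).
Proof.
apply: (iffP (ltn_bigminnP _ _ _ _)) => [[_ degG] x|degG]; first exact: degG.
split=> //; have /card_gt0P[x _] := vertex_gt0 G.
exact: ltn_trans (degree_ltn x).
Qed.

Lemma min_degreeVle (G : sgraph) k :
  k < min_degree G \/ exists x : G, degree x <= k.
Proof.
case: (boolP [exists x : G, degree x <= k]) => [/existsP|]; first by right.
move=> /existsPn degG; left; apply/min_degree_gtP => x.
by rewrite ltnNge degG.
Qed.

Lemma separatorP (G : sgraph) (S : {set G}) :
  reflect (exists x y : G, [/\ x \notin S, y \notin S &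
      ~~ connect (fun u v => [&& u \notin S, v \notin S & adj u v]) x y])
    (separator S).
Proof.
apply: (iffP existsP) => [[x /existsP[y /and3P[]]]|[x [y [xS yS xy]]]].
  by exists x, y; split.
by exists x; apply/existsP; exists y; apply/and3P.
Qed.

(** The neighbourhood of [x] separates [x] from any non-neighbour. If [x] is adjacent to all other
    vertices, its degree is [#|G|.-1], the default value in [connectivity]. *)
Lemma connectivity_leq_min_degree (G : sgraph) :
  connectivity G <= min_degree G.
Proof.
case def_k: (connectivity G) => [//|k]; apply/min_degree_gtP => x.
have /ltn_bigminnP[k_lt sepG] : k < connectivity G by rewrite def_k.
case: (boolP [exists y, (y != x) && ~~ adj x y]) => [/existsP[y /andP[yx xy]]|].
  apply/sepG/separatorP; exists x, y; split; rewrite ?inE ?adj_irrefl //.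
  apply/connectP => -[[|z p] /=]; first by move=> _ yE; rewrite yE eqxx in yx.
  by rewrite !inE => /andP[/and3P[_ /negP + /[dup]]].
move=> /existsPn adjx; rewrite /degree.
suff -> : [set y | adj x y] = [set~ x] by rewrite cardsC1.
apply/setP => y; rewrite !inE; have := adjx y.
by case: (eqVneq y x) => [->|_] /=; rewrite ?adj_irrefl // negbK.
Qed.

Lemma multipartite_adj (G : sgraph) :
  complete_multipartite G ->
  forall x y : G, ~~ adj x y -> forall z, adj x z = adj y z.
Proof.
by case=> c [f adjE] x y; rewrite adjE negbK => /eqP fxy z; rewrite !adjE fxy.
Qed.

Lemma min_degree_leq_card (G : sgraph) k : k < min_degree G -> k < #|G|.-1.
Proof.
move=> /min_degree_gtP degG; have /card_gt0P[x _] := vertex_gt0 G.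
by have := degG x; have := degree_ltn x; lia.
Qed.

Lemma multipartite_connectivity (G : sgraph) :
  complete_multipartite G -> connectivity G = min_degree G.
Proof.
move=> mG; apply/eqP; rewrite eqn_leq connectivity_leq_min_degree /=.
case def_k: (min_degree G) => [//|k].
have ltk : k < min_degree G by rewrite def_k.
apply/ltn_bigminnP; split=> [|S /separatorP[x [y [xS yS Nxy]]]].
  exact: min_degree_leq_card.
have /min_degree_gtP/(_ x) ltkx := ltk.
apply: leq_trans ltkx (subset_leq_card _); apply/subsetP => z /[!inE] xz.
apply: contraNT Nxy => zS.
have [xy|Nxy] := boolP (adj x y); first by apply: connect1; rewrite xS yS.
apply: (@connect_trans _ _ z); apply: connect1; first by rewrite xS zS.
by rewrite yS zS adj_sym -(multipartite_adj mG Nxy).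
Qed.

(** * Isomorphism invariance *)

Lemma giso_sym (G H : sgraph) : giso G H -> giso H G.
Proof.
case=> f [g fK gK] fP; exists g; first by exists f.
by move=> x y; rewrite -fP !gK.
Qed.

Lemma giso_card (G H : sgraph) : giso G H -> #|G| = #|H|.
Proof. by case=> f /bij_eq_card. Qed.

Lemma giso_multipartite (G H : sgraph) :
  giso H G -> complete_multipartite G -> complete_multipartite H.
Proof.
case=> f _ fP [c [h hP]]; exists c, (h \o f) => x y /=.
by rewrite -fP hP.
Qed.

Lemma giso_degree (G H : sgraph) (f : G -> H) :
  bijective f -> (forall x y : G, adj (f x) (f y) = adj x y) ->
  forall x, degree (f x) = degree x.
Proof.
move=> bij_f fP x; rewrite /degree -(card_imset _ (bij_inj bij_f)).
case: bij_f => g fK gK; apply: eq_card => y; rewrite inE; apply/idP/imsetP.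
  by exists (g y); rewrite ?inE ?gK // -fP gK.
by case=> z; rewrite inE => xz ->; rewrite fP.
Qed.

Lemma giso_leq_min_degree (G H : sgraph) :
  giso G H -> min_degree G <= min_degree H.
Proof.
case=> f bij_f fP; case def_k: (min_degree G) => [//|k].
have /min_degree_gtP ltk : k < min_degree G by rewrite def_k.
apply/min_degree_gtP => y; case: (bij_f) => g _ gK.
by rewrite -(gK y) (giso_degree bij_f).
Qed.

Lemma giso_min_degree (G H : sgraph) : giso G H -> min_degree G = min_degree H.
Proof.
move=> isoGH; apply/eqP; rewrite eqn_leq giso_leq_min_degree //=.
exact/giso_leq_min_degree/giso_sym.
Qed.

Lemma giso_multipartite_connectivity (G H : sgraph) :
  complete_multipartite G -> giso H G -> connectivity H = connectivity G.
Proof.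
move=> mG isoHG; have mH := giso_multipartite isoHG mG.
by rewrite !multipartite_connectivity // (giso_min_degree isoHG).
Qed.

Lemma giso_refl (G : sgraph) : giso G G.
Proof. by exists id => //; exists id. Qed.

(** * Minors and proper minors *)

Lemma minor_refl (G : sgraph) : minor G G.
Proof. by exists G; [apply: reduces_refl | apply: giso_refl]. Qed.

Lemma reduces_minor (G H : sgraph) : reduces G H -> minor H G.
Proof. by exists H => //; apply: giso_refl. Qed.

(** Treats (a) and (b) alike, with [par] the connectivity or the minimum degree. If [par G] were at
    most [k], so would be [par] of every minor, whether proper or isomorphic to [G]. *)
Lemma minimal_forbidden_gt (par : sgraph -> nat) k (G : sgraph) :
    (forall H, giso H G -> par H = par G) ->
    minimal_forbidden (fun G => forall H, minor H G -> par H <= k) G ->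
  k < par G /\ forall H, proper_minor H G -> par H <= k.
Proof.
move=> par_iso [NXG XG].
have XG' H : proper_minor H G -> par H <= k.
  by move/XG; apply; apply: minor_refl.
split=> //; rewrite ltnNge; apply/negP => parG; apply: NXG => H minH.
rewrite leqNgt; apply/negP => parH.
suff : par H <= k by rewrite leqNgt parH.
by apply: XG'; split=> // /par_iso eq_par; rewrite eq_par ltnNge parG in parH.
Qed.

Lemma del_vertex_proper (G : sgraph) (v : G) (G_gt1 : 1 < #|G|) :
  proper_minor (del_vertex v G_gt1) G.
Proof.
split=> [|/giso_card]; first exact/reduces_minor/reduces_del_vertex/reduces_refl.
by rewrite card_sig cardC1 => /eqP; rewrite ltn_eqF // ltn_predL vertex_gt0.
Qed.

Lemma contract_proper (G : sgraph) (x y : G) (xy : adj x y) :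
  proper_minor (contract xy) G.
Proof.
split=> [|/giso_card]; first exact/reduces_minor/reduces_contract/reduces_refl.
by rewrite card_sig cardC1 => /eqP; rewrite ltn_eqF // ltn_predL vertex_gt0.
Qed.

(** The vertex counts agree, so ordered pairs of adjacent vertices are counted: an isomorphism would
    give [#|E| <= #|E'|], yet [E'] lies in [E] and lacks [(x, y)]. *)
Lemma del_edge_proper (G : sgraph) (x y : G) :
  adj x y -> proper_minor (del_edge x y) G.
Proof.
move=> xy; split.
  exact/reduces_minor/reduces_del_edge/reduces_refl.
case=> f bij_f fP.
pose E := [set p : G * G | adj p.1 p.2].
pose E' := [set p : G * G | @adj (del_edge x y) p.1 p.2].
pose h (p : G * G) : G * G := (f p.1, f p.2).
have h_inj : injective h.
  by move=> [u1 u2] [v1 v2] [/(bij_inj bij_f) -> /(bij_inj bij_f) ->].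
have : #|E| <= #|E'|.
  rewrite -[X in _ <= X](card_imset _ h_inj); apply/subset_leq_card/subsetP => -[u v].
  case: bij_f => g fK gK; rewrite inE /= => uv.
  by apply/imsetP; exists (g u, g v); rewrite /h /= ?gK // inE -fP !gK.
rewrite leqNgt => /negP[]; apply/proper_card/properP; split.
  by apply/subsetP => -[u v]; rewrite !inE => /andP[].
by exists (x, y); rewrite !inE //= /del_edge_adj eqxx andbF.
Qed.

(** * Degrees, colourings and separators after one reduction *)

Lemma del_vertex_degree (G : sgraph) (v : G) (G_gt1 : 1 < #|G|)
    (x : del_vertex v G_gt1) :
  degree (sval x) <= degree x + adj (sval x) v.
Proof.
have -> : degree x = #|sval @: [set y | adj x y]|.
  by rewrite card_imset //; apply: val_inj.
rewrite /degree [X in X <= _](cardD1 v) inE addnC leq_add2r.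
apply/subset_leq_card/subsetP => z /[!inE] /andP[zv xz].
by apply/imsetP; exists (Sub z zv); rewrite ?inE.
Qed.

(** Among the neighbours of [z], [y] is replaced by [x]; one is lost only when both were present. *)
Lemma contract_degree (G : sgraph) (x y : G) (xy : adj x y) (z : contract xy) :
  sval z != x ->
  degree (sval z) <= degree z + (adj (sval z) x && adj (sval z) y).
Proof.
move=> zx; have yx : x != y by apply: contraTneq (xy) => ->; rewrite adj_irrefl.
have -> : degree z = #|sval @: [set u | adj z u]|.
  by rewrite card_imset //; apply: val_inj.
have sub u : u != y -> adj (sval z) u -> u \in sval @: [set u | adj z u].
  move=> uy zu; apply/imsetP; exists (Sub u uy); rewrite ?inE //.
  rewrite /= /contract_adj /= zu andbT; apply: contraTneq zu => ->.
  by rewrite adj_irrefl.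
have subx : adj (sval z) y -> x \in sval @: [set u | adj z u].
  move=> zy; apply/imsetP; exists (Sub x yx); rewrite ?inE //.
rewrite /= /contract_adj /= eqxx (adj_sym y (sval z)) zy !orbT andbT.
  by apply: contraNneq zx => ->.
have [zy|Nzy] := boolP (adj (sval z) y); last first.
  rewrite andbF addn0; apply/subset_leq_card/subsetP => u /[!inE] zu.
  by apply: sub => //; apply: contraNneq Nzy => uy; move: zu; rewrite uy.
rewrite /degree (cardD1 y) inE zy andbT addnC.
have [zx'|Nzx] := boolP (adj (sval z) x).
  rewrite leq_add2r; apply/subset_leq_card/subsetP => u /[!inE] /andP[uy zu].
  exact: sub.
rewrite addn0 [X in _ <= X](cardD1 x) subx // addnC leq_add2l.
apply/subset_leq_card/subsetP => u /[!inE] /andP[uy zu].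
by rewrite sub // andbT; apply: contraNneq Nzx => <-.
Qed.

(** [x] and [y] have different colours, so every other vertex is adjacent to one of them and hence
    to the merged vertex. *)
Lemma contract_degree_merged (G : sgraph) (x y : G) (xy : adj x y)
    (z : contract xy) :
    complete_multipartite G -> sval z = x -> degree z = #|G|.-2.
Proof.
move=> mG zx; rewrite /degree.
suff -> : [set u | adj z u] = [set~ z] by rewrite cardsC1 /= card_sig cardC1.
apply/setP => u; rewrite !inE /= /contract_adj eq_sym /= zx eqxx /=.
case: eqP => //= _; have [//|Nxu] := boolP (adj x (sval u)).
by rewrite (adj_sym y) -(multipartite_adj mG Nxu) xy.
Qed.

Lemma del_vertex_multipartite (G : sgraph) (v : G) (G_gt1 : 1 < #|G|) :
  complete_multipartite G -> complete_multipartite (del_vertex v G_gt1).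
Proof. by case=> c [f fP]; exists c, (f \o sval) => x y; apply: fP. Qed.

(** The merged vertex is adjacent to all others, so it gets the fresh colour [ord0]. *)
Lemma contract_multipartite (G : sgraph) (x y : G) (xy : adj x y) :
  complete_multipartite G -> complete_multipartite (contract xy).
Proof.
move=> [c [f fP]]; exists c.+1.
exists (fun u : contract xy => if sval u == x then ord0 else lift ord0 (f (sval u))).
have fxy : f y != f x by rewrite eq_sym -fP.
move=> u v /=; rewrite /contract_adj -val_eqE /= !fP.
case: (eqVneq (sval u) x) => [->|ux]; case: (eqVneq (sval v) x) => [->|vx] //=.
- by rewrite orbF; case: (eqVneq (f x) (f (sval v))) => //= <-.
- by rewrite ux /=; case: (eqVneq (f (sval u)) (f x)) => //= ->.
- rewrite orbF (inj_eq (@lift_inj _ _)).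
  by case: (eqVneq (sval u) (sval v)) => [->|//]; rewrite eqxx.
Qed.

(** Without the edge [xy] the graph need not be multipartite, so its separators are bounded
    directly: [S] contains a whole neighbourhood of [G], or all but one vertex of the neighbourhood
    of [x] or of [y]. *)
Lemma del_edge_separator (G : sgraph) (x y u v : G) (S : {set G}) k :
    complete_multipartite G -> (forall z : G, k < degree z) ->
    adj x y -> k.+1 < degree x -> k.+1 < degree y ->
    u \notin S -> v \notin S ->
    ~~ connect (fun u v => [&& u \notin S, v \notin S & @adj (del_edge x y) u v])
         u v ->
  k < #|S|.
Proof.
move=> mG degG xy ltx lty uS vS.
set e := (fun _ _ => _) => Nuv.
have e_sym : connect_sym e.
  by apply: sym_connect_sym => s t; rewrite /e adj_sym andbCA.
have edge s t : s \notin S -> t \notin S -> adj s t ->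
    (s, t) != (x, y) -> (s, t) != (y, x) -> connect e s t.
  move=> sS tS st; rewrite !xpair_eqE => ne1 ne2; apply: connect1.
  rewrite /e sS tS /= /del_edge_adj st /=.
  apply/eqP => eq_st; have := set21 s t; have := set22 s t; rewrite eq_st !inE.
  case/pred2P=> tE /pred2P[] sE; move: st ne1 ne2; rewrite sE tE !eqxx //=.
    by rewrite adj_irrefl.
  by rewrite adj_irrefl.
have large z w : (forall t, adj z t -> t != w -> t \in S) -> k.+1 < degree z ->
    k < #|S|.
  move=> subS; rewrite /degree (cardsD1 w) => ltz.
  apply: (@leq_trans #|[set t | adj z t] :\ w|).
    by case: (_ \in _) ltz; lia.
  by apply/subset_leq_card/subsetP => t /[!inE] /andP[tw zt]; apply: subS.
have neq_adj (s t : G) : adj s t -> s != t.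
  by apply: contraTneq => ->; rewrite adj_irrefl.
have [xNy yNx] : x != y /\ y != x by rewrite !neq_adj // adj_sym.
have [uv|Nadj_uv] := boolP (adj u v).
  wlog: u v uS vS Nuv uv / (u, v) = (x, y).
    move=> IH; have [uvE|ne1] := eqVneq (u, v) (x, y); first exact: (IH u v).
    have [[uE vE]|ne2] := eqVneq (u, v) (y, x).
      by apply: (IH v u); rewrite ?(e_sym v) ?(adj_sym v) // uE vE.
    by rewrite edge in Nuv.
  case=> uE vE; rewrite {}uE {}vE {uv} in uS vS Nuv.
  have [subx|] := boolP [forall t, adj x t && (t != y) ==> (t \in S)].
    by apply: (large x y) => // t xt ty; have/forallP/(_ t) := subx; rewrite xt ty.
  move=> /forallPn[w]; rewrite negb_imply => /andP[/andP[xw wNy] wS].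
  (* A neighbour [t] of [y] outside [S] would give a path [x t y], or [x w t y] when [t] has the
     colour of [x]. *)
  apply: (large y x) => // t yt tNx; apply: contraNT Nuv => tS.
  have wNx : w != x by rewrite eq_sym neq_adj.
  have tNy : t != y by rewrite eq_sym neq_adj.
  have conn_ty : connect e t y.
    by apply: edge; rewrite // 1?adj_sym // !xpair_eqE ?(negPf tNx) ?(negPf tNy).
  apply: connect_trans conn_ty.
  have [xt|Nxt] := boolP (adj x t).
    by apply: edge; rewrite // !xpair_eqE ?(negPf tNy) ?(negPf tNx) ?andbF.
  apply: (@connect_trans _ _ w); apply: edge; rewrite // ?xpair_eqE.
  - by rewrite (negPf wNy) andbF.
  - by rewrite (negPf wNx) andbF.
  - by rewrite adj_sym -(multipartite_adj mG Nxt).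
  - by rewrite (negPf wNx).
  - by rewrite (negPf wNy).
(* Nonadjacent [u] and [v] share their neighbours, so a neighbour [t] outside [S] links them unless
   [ut] or [tv] is the deleted edge. *)
have nbr t : adj u t -> (u, t) != (x, y) -> (u, t) != (y, x) ->
    (t, v) != (x, y) -> (t, v) != (y, x) -> t \in S.
  move=> ut ne1 ne2 ne3 ne4; apply: contraNT Nuv => tS.
  apply: (@connect_trans _ _ t); apply: edge => //.
  by rewrite adj_sym -(multipartite_adj mG Nadj_uv).
have [uvx|] := boolP (x \in [set u; v]).
  apply: (large x y) => // t xt tNy.
  have tNx : t != x by rewrite eq_sym neq_adj.
  apply: nbr; rewrite ?xpair_eqE ?(negPf tNx) ?(negPf tNy) ?andbF //.
  by move: uvx xt; rewrite !inE => /pred2P[]-> //; rewrite (multipartite_adj mG Nadj_uv).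
have [uvy _|] := boolP (y \in [set u; v]).
  apply: (large y x) => // t yt tNx.
  have tNy : t != y by rewrite eq_sym neq_adj.
  apply: nbr; rewrite ?xpair_eqE ?(negPf tNx) ?(negPf tNy) ?andbF //.
  by move: uvy yt; rewrite !inE => /pred2P[]-> //; rewrite (multipartite_adj mG Nadj_uv).
rewrite !inE ![_ == u]eq_sym ![_ == v]eq_sym !negb_or.
move=> /andP[uNy vNy] /andP[uNx vNx].
apply: leq_trans (degG u) (subset_leq_card _); apply/subsetP => t /[!inE] ut.
apply: nbr; rewrite ?xpair_eqE ?(negPf uNx) ?(negPf uNy) //.
- by rewrite (negPf vNy) andbF.
- by rewrite (negPf vNx) andbF.
Qed.

(** * Colour classes and recognition of [Kab] *)

Lemma multipartite_class_card (G : sgraph) (I : finType) (f : G -> I) x :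
  (forall x y : G, adj x y = (f x != f y)) ->
  #|[set y | f y == f x]| + degree x = #|G|.
Proof.
move=> fP; rewrite -(cardsC [set y | f y == f x]); congr (_ + _).
by apply: eq_card => y; rewrite !inE fP eq_sym.
Qed.

Lemma card_fibers (T I : finType) (f : T -> I) (A : {set T}) :
  #|A| = \sum_i #|[set x in A | f x == i]|.
Proof.
rewrite -sum1_card (partition_big f xpredT) //=; apply: eq_bigr => i _.
by rewrite -sum1_card; apply: eq_bigl => x; rewrite inE.
Qed.

Lemma card_Kab a b p (a_gt0 : 0 < a) : #|Kab b p a_gt0| = a + p * b.
Proof.
rewrite card_tagged sumnE big_map big_enum /=.
under eq_bigr do rewrite card_ord.
transitivity (sumn (a :: nseq p b)); last by rewrite /= sumn_nseq mulnC.
by rewrite sumnE (big_nth 0) big_mkord.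
Qed.

(** The class of [w] gets index 0; the other colours in use are exactly those of the neighbours of
    [w]. A vertex is sent to the index of its colour and its rank within its class. *)
Lemma Kab_giso (G : sgraph) (I : finType) (f : G -> I) (w : G) b
    (w_gt0 : 0 < #|[set v | f v == f w]|) :
    (forall x y : G, adj x y = (f x != f y)) ->
    (forall v : G, f v != f w -> #|[set u | f u == f v]| = b) ->
  giso G (Kab b #|f @: [set v | adj w v]| w_gt0).
Proof.
move=> fP fb; set P := f @: _; set p := #|P|.
set ns := #|[set v | f v == f w]| :: nseq p b.
pose idx v := if f v == f w then 0 else (index (f v) (enum P)).+1.
have in_P v : f v != f w -> index (f v) (enum P) < p.
  move=> vw; rewrite /p cardE index_mem mem_enum; apply/imsetP.
  by exists v; rewrite ?inE // fP eq_sym.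
have idx_lt v : idx v < size ns.
  by rewrite /= size_nseq /idx; case: ifPn => // /in_P.
pose pos v := index v (enum [set u | f u == f v]).
have pos_lt v : pos v < nth 0 ns (Ordinal (idx_lt v)).
  rewrite /= /idx; case: (eqVneq (f v) (f w)) => [fvw|vw] /=.
    by rewrite /pos fvw cardE index_mem mem_enum inE fvw.
  by rewrite nth_nseq in_P // -(fb v vw) cardE index_mem mem_enum inE.
pose h v : Kab b p w_gt0 :=
  @Tagged _ (Ordinal (idx_lt v)) (fun i : 'I_(size ns) => 'I_(nth 0 ns i))
    (Ordinal (pos_lt v)).
have idx_eq u v : (idx u == idx v) = (f u == f v).
  apply/eqP/eqP => [|fuv]; last by rewrite /idx fuv.
  rewrite /idx; case: (eqVneq (f u) (f w)) => [->|uw];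
    case: (eqVneq (f v) (f w)) => [->|vw] //= [].
  move=> eq_i; rewrite -[LHS](nth_index (f w) (s := enum P)).
    by rewrite eq_i nth_index // -index_mem -cardE in_P.
  by rewrite -index_mem -cardE in_P.
have tag_h u v : (tag (h u) == tag (h v)) = (f u == f v).
  by rewrite -val_eqE /= idx_eq.
exists h; last by move=> x y; rewrite fP /= /K_adj tag_h.
apply: inj_card_bij; last first.
  rewrite card_Kab -(multipartite_class_card w fP) leq_add2l /degree.
  rewrite -sum1_card (partition_big f (mem P)) /=; last first.
    by move=> v wv; apply: imset_f.
  rewrite -sum_nat_const; apply/eq_leq/eq_bigr => i /imsetP[v].
  rewrite inE fP eq_sym => vw ->; rewrite -(fb v vw) -sum1_card.
  apply: eq_bigl => u; rewrite !inE fP; case: eqVneq => [->|]; rewrite ?andbF //.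
  by rewrite eq_sym vw.
move=> u v huv; have fuv : f u = f v by apply/eqP; rewrite -tag_h huv.
have : pos u = pos v.
  exact: (congr1 (fun t : K_vertex ns => val (tagged t)) huv).
rewrite /pos fuv => eq_pos.
rewrite -[LHS](nth_index u (s := enum [set t | f t == f v])).
  by rewrite eq_pos nth_index // mem_enum inE.
by rewrite mem_enum inE fuv.
Qed.

(** * From a minimal forbidden minor to [Kab] *)

Section Critical.
Variables (k : nat) (G : sgraph).
Hypotheses (k_ge1 : 1 <= k) (mG : complete_multipartite G).
Hypothesis degG : forall x : G, k < degree x.
Hypothesis proper_conn : forall H, proper_minor H G -> connectivity H <= k.

Lemma proper_multipartite_degree (H : sgraph) :
  proper_minor H G -> complete_multipartite H -> exists x : H, degree x <= k.
Proof.
move=> /proper_conn + mH; rewrite multipartite_connectivity // leqNgt.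
by case: (min_degreeVle H k) => [->|].
Qed.

Lemma critical_neighbor (v : G) : exists2 x : G, adj v x & degree x = k.+1.
Proof.
have G_gt1 : 1 < #|G| by have := degree_ltn v; have := degG v; lia.
have [|x le_x] := proper_multipartite_degree (del_vertex_proper v G_gt1).
  exact: del_vertex_multipartite.
move: (degG (sval x)) (del_vertex_degree x); rewrite adj_sym => lt_x.
by case vx: (adj v _) => ?; exists (sval x) => //; lia.
Qed.

Lemma critical_edge (x y : G) :
  adj x y -> degree x = k.+1 \/ degree y = k.+1.
Proof.
move=> xy; have := degG x; rewrite leq_eqVlt => /predU1P[->|ltx]; first by left.
have := degG y; rewrite leq_eqVlt => /predU1P[->|lty]; first by right.
have := proper_conn (del_edge_proper xy); rewrite leqNgt => /negP[].
have ltk : k < min_degree G by apply/min_degree_gtP.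
apply/ltn_bigminnP; split; first exact: (min_degree_leq_card ltk).
move=> S /separatorP[u [v [uS vS Nuv]]].
exact: (@del_edge_separator G x y u v S k mG degG xy ltx lty uS vS Nuv).
Qed.

(** Contract an edge [xy] whose ends have degree [k.+1]. A vertex of degree at most [k] in the
    result is a common neighbour of [x] and [y] that lost one neighbour, or else the merged vertex,
    and then [G] is complete. *)
Lemma critical_triangle : exists x y z : G,
  [/\ adj x y, adj x z & adj y z] /\
  [/\ degree x = k.+1, degree y = k.+1 & degree z = k.+1].
Proof.
have /card_gt0P[v _] := vertex_gt0 G.
have [x _ dx] := critical_neighbor v.
have [y xy dy] := critical_neighbor x.
have [|z le_z] := proper_multipartite_degree (contract_proper xy).
  exact: contract_multipartite.
exists x, y; have [zx|zNx] := eqVneq (sval z) x; last first.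
  move: (degG (sval z)) (contract_degree zNx); rewrite !(adj_sym (sval z)).
  case xz: (adj x _) => /=; last by lia.
  case yz: (adj y _) => /=; last by lia.
  by exists (sval z); split; split=> //; lia.
rewrite (contract_degree_merged mG zx) in le_z.
(* As [k >= 1], [x] has a second neighbour. *)
have [w] : exists w, w \in [set t | adj x t] :\ y.
  apply/card_gt0P; have := cardsD1 y [set t | adj x t].
  by rewrite -/(degree x) dx inE xy; lia.
rewrite !inE => /andP[wNy xw]; exists w.
have yw : adj y w.
  apply: contraT; rewrite adj_sym => Nwy; have := degG w; rewrite ltnNge.
  case/negP; apply: leq_trans le_z; apply: (@leq_trans #|~: [set w; y]|).
    apply/subset_leq_card/subsetP => u /[!inE]; apply: contraTN.
    by move=> /pred2P[]->; rewrite ?adj_irrefl.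
  by rewrite [X in X <= _]cardsCs setCK cards2 wNy subn2.
by split; split=> //; have := degG w; have := degree_ltn w; lia.
Qed.

Lemma critical_giso : exists (a b p : nat) (a_ge1 : 1 <= a),
  [/\ a <= b, 2 <= p, k + 1 = a + (p - 1) * b,
      giso G (Kab b p a_ge1) & (p = 2 -> a = b)].
Proof.
case: (mG) => c [f fP].
have [x [y [z [[xy xz yz] [dx dy dz]]]]] := critical_triangle.
have class_card v := multipartite_class_card v fP.
have deg_class u v : f u = f v -> degree u = degree v.
  by move=> fuv; have := class_card u; have := class_card v; rewrite fuv; lia.
(* The class of [w] will have size [a]. The classes of its neighbours, of degree [k.+1], all have
   size [#|G| - k.+1], which is [b]. *)
suff [w dw [p_ge2 p2]] : exists2 w : G,
    forall v, adj w v -> degree v = k.+1 &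
    let p := #|f @: [set v | adj w v]| in
    2 <= p /\ (p = 2 -> degree w = k.+1).
  have w_gt0 : 0 < #|[set v | f v == f w]|.
    by apply/card_gt0P; exists w; rewrite inE.
  have isoG : giso G (Kab (#|G| - k.+1) #|f @: [set v | adj w v]| w_gt0).
    apply: Kab_giso => // v vw; rewrite -(class_card v) dw ?addnK //.
    by rewrite fP eq_sym.
  have := giso_card isoG; rewrite card_Kab => cardG.
  have := class_card w; have := degG w; move: p_ge2 p2 isoG cardG.
  set p := #|f @: _|; set a := #|_|; set n := #|G| => p_ge2 p2 isoG cardG ltw aw.
  exists a, (n - k.+1), p, w_gt0; split=> //; first by lia.
    have bE : n = k.+1 + (n - k.+1) by lia.
    have : p = (p - 1).+1 by lia.
    by move: (p - 1) cardG => q cardG pE; move: cardG; rewrite pE mulSn; lia.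
  by move/p2; lia.
(* If all degrees are [k.+1], then [w = x] serves, and [y] and [z] supply two other colours. *)
have [/forallP allk|] := boolP [forall w : G, degree w == k.+1].
  exists x => [v _|]; first exact/eqP.
  split=> //; apply: (@leq_trans #|[set f y; f z]|).
    by rewrite cards2 -fP yz.
  by apply/subset_leq_card/subsetP => i /[!inE] /pred2P[]->; apply: imset_f;
     rewrite inE.
(* All neighbours of a vertex [w] of larger degree have degree [k.+1]. The three colours of the
   triangle differ from that of [w], so [p] exceeds 2. *)
move=> /forallPn[w Nw].
have adjw v : degree v = k.+1 -> adj w v.
  by move=> dv; rewrite fP; apply: contraNneq Nw => /deg_class ->; apply/eqP.
exists w => [v /critical_edge[dw|//]|]; first by rewrite dw eqxx in Nw.
suff p_gt2 : 2 < #|f @: [set v | adj w v]| by split; [exact: ltnW | lia].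
apply: (@leq_trans #|f x |: [set f y; f z]|).
  by rewrite cardsU1 cards2 !inE negb_or -!fP xy xz yz.
by apply/subset_leq_card/subsetP => i /[!inE] /predU1P[|/pred2P[]]->;
   apply: imset_f; rewrite inE adjw.
Qed.
End Critical.

(** * Branch sets and minimality of [Kab] *)

(* The branch set of a vertex [h] of a minor is [g @^-1: [set Some h]]. Its
   connectedness is never needed, so it is not recorded. *)
Definition branching (G H : sgraph) (g : G -> option H) : Prop :=
  (forall h, exists u, g u = Some h) /\
  (forall h h', adj h h' -> exists u v, [/\ g u = Some h, g v = Some h' & adj u v]).

(** Deleting a vertex discards its branch set, deleting an edge keeps all branch sets, and
    contracting [xy] merges the branch set of [y] into that of [x], by means of [q]. *)
Lemma reduces_branching (G H : sgraph) :
  reduces G H -> exists g : G -> option H, branching g.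
Proof.
elim=> {H} [|H v H_gt1 _ [g [g_surj g_adj]]|H x y xy _ [g [g_surj g_adj]]|
            H x y xy _ [g [g_surj g_adj]]].
- by exists Some; split=> [h|h h' hh']; [exists h | exists h, h'].
- exists (fun u => obind insub (g u)); split=> [h|h h' hh'].
    by have [u gu] := g_surj (sval h); exists u; rewrite gu /= valK.
  have [u [u' [gu gu' uu']]] := g_adj _ _ hh'.
  by exists u, u'; rewrite gu gu' /= !valK.
- by exists g; split=> // h h' /andP[/g_adj].
have xNy : x != y by apply: contraTneq (xy) => ->; rewrite adj_irrefl.
pose q z : option (contract xy) := insub (if z == y then x else z).
have qE (h : contract xy) : q (sval h) = Some h.
  by rewrite /q (negPf (svalP h)) valK.
have qy (h : contract xy) : sval h = x -> q y = Some h.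
  by move=> hx; rewrite /q eqxx -(valK h); apply/congr1/esym.
exists (fun u => obind q (g u)); split=> [h|h h'].
  by have [u gu] := g_surj (sval h); exists u; rewrite gu /= qE.
case/andP=> _ /or3P[/g_adj|/andP[/eqP hx /g_adj]|/andP[/eqP hx]].
- by case=> u [u' [gu gu' uu']]; exists u, u'; rewrite gu gu' /= !qE.
- by case=> u [u' [gu gu' uu']]; exists u, u'; rewrite gu gu' /= qE (qy h).
rewrite adj_sym => /g_adj[u [u' [gu gu' uu']]].
by exists u, u'; rewrite gu gu' /= qE (qy h').
Qed.

Lemma minor_branching (G H : sgraph) :
  minor H G -> exists g : G -> option H, branching g.
Proof.
case=> H' /reduces_branching[g [g_surj g_adj]] [f [f' fK f'K] fP].
exists (fun u => omap f (g u)); split=> [h|h h'].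
  by have [u gu] := g_surj (f' h); exists u; rewrite gu /= f'K.
rewrite -[h]f'K -[h']f'K fP => /g_adj[u [u' [gu gu' uu']]].
by exists u, u'; rewrite gu gu'.
Qed.

Lemma branching_min_degree (G H : sgraph) (g : G -> option H)
    (I : finType) (f : G -> I) (i0 : I) a b p :
    branching g -> (forall x y : G, adj x y = (f x != f y)) ->
    #|[set x | f x == i0]| = a ->
    (forall i, i != i0 -> #|[set x | f x == i]| = b) ->
    #|I| = p.+1 -> a <= b -> 2 <= p -> (p = 2 -> a = b) ->
    (forall h : H, a + (p - 1) * b <= degree h) ->
  giso H G.
Proof.
move=> [g_surj g_adj] fP card_i0 card_i cardI ab p_ge2 p2 degH.
have cardG : #|G| = a + p * b.
  rewrite -cardsT (card_fibers f) (bigD1 i0) //=; congr (_ + _).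
    by rewrite -card_i0; apply: eq_card => x; rewrite !inE.
  rewrite (eq_bigr (fun=> b)) => [|i ii0]; last first.
    by rewrite -(card_i i ii0); apply: eq_card => x; rewrite !inE.
  by rewrite sum_nat_const; congr (_ * _); have := cardC1 i0; rewrite cardI.
have [rho rhoK] := fin_all_exists g_surj.
have rho_inj : injective rho by move=> h h' /(congr1 g); rewrite !rhoK => -[].
pose B h := [set u | g u == Some h].
have rhoB h : rho h \in B h by rewrite inE rhoK.
pose Sg := [set h | #|B h| == 1].
have SgB h u : h \in Sg -> g u = Some h -> u = rho h.
  rewrite inE => /cards1P[w Bw] gu; have := rhoB h.
  have : u \in B h by rewrite inE gu.
  by rewrite Bw !inE => /eqP-> /eqP.
(* With [r = #|G| - #|H|], there are at most [r] non-singleton branch sets, and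
   at most [b - r] singleton ones of each colour [i]: a singleton of colour [i]
   is adjacent to none of them. *)
have sumB : #|H| + #|~: Sg| <= #|G|.
  rewrite -(cardsC (rho @: setT)) (card_imset _ rho_inj).
  rewrite !cardsT leq_add2l -(card_imset _ (@Some_inj _)).
  apply: leq_trans (leq_imset_card g _); apply/subset_leq_card/subsetP.
  move=> _ /imsetP[h + ->]; rewrite !inE (cardsD1 (rho h)) rhoB => Bh.
  have /card_gt0P[u /[!inE] /andP[uNrho /eqP gu]] : 0 < #|B h :\ rho h| by lia.
  apply/imsetP; exists u => //; rewrite inE; apply: contra uNrho => /imsetP[h' _ uE].
  by move: gu; rewrite uE rhoK => -[->].
pose s i := #|[set h in Sg | f (rho h) == i]|.
have sumS : #|Sg| = \sum_i s i by apply: card_fibers.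
have pb : p * b = (p - 1) * b + b by rewrite mulnBl mul1n subnK // leq_pmull; lia.
have s_b i : s i + #|G| <= #|H| + b.
  (* [#|G|] is [a + (p - 1) * b + b], and [a + (p - 1) * b] bounds degrees in [H] from below. *)
  suff : s i + (a + (p - 1) * b) <= #|H| by lia.
  have [|] := posnP (s i).
    move=> ->; have /card_gt0P[h _] := vertex_gt0 H.
    exact: leq_trans (degH h) (ltnW (degree_ltn h)).
  case/card_gt0P=> h; rewrite inE => /andP[Sh /eqP hi].
  apply: leq_trans (_ : s i + degree h <= _); first by rewrite leq_add2l.
  rewrite -(cardsC [set h in Sg | f (rho h) == i]) leq_add2l.
  apply/subset_leq_card/subsetP => h'; rewrite in_set in_setC in_set => hh'.
  apply/negP => /andP[Sh' /eqP h'i]; have [u [v [gu gv]]] := g_adj h h' hh'.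
  by rewrite fP (SgB h u Sh gu) (SgB h' v Sh' gv) hi h'i eqxx.
have s_a : s i0 <= a.
  rewrite /s -card_i0 -(card_imset _ rho_inj); apply/subset_leq_card/subsetP.
  by move=> _ /imsetP[h /[!inE] /andP[_ hi] ->].
have cardH : #|H| = #|G|.
  apply/eqP; rewrite eqn_leq (leq_trans (leq_addr _ _) sumB) /= -subn_eq0.
  have sum_b : \sum_(i | i != i0) s i + p * (#|G| - #|H|) <= p * b.
    have -> : p = #|[pred i | i != i0]| by have := cardC1 i0; rewrite cardI.
    rewrite -!sum_nat_const -big_split /=; apply: leq_sum => i _.
    rewrite addnBA ?leq_subLR ?s_b //; exact: leq_trans (leq_addr _ _) sumB.
  have /subnKC : #|H| <= #|G| := leq_trans (leq_addr _ _) sumB.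
  have := cardsC Sg; rewrite sumS (bigD1 i0) //=.
  move: sum_b (s_b i0) sumB cardG s_a.
  move: (\sum_(i | _) _) (s i0) #|~: Sg| #|H| #|G| => S s0 t m n.
  move: (n - m) => r sum_b s_b0 le_mt nE s0_a cardSg mr.
  (* The count gives [(p - 2) * r + a <= s0]. For [p = 2], use [s0 + r <= b] and [a = b]; for larger
     [p], use [s0 <= a]. *)
  have [p_eq2|p_neq2] := eqVneq p 2.
    by have := p2 p_eq2; rewrite p_eq2 in sum_b nE; lia.
  have : 3 * r <= p * r by rewrite leq_mul2r; lia.
  by lia.
have allS h : h \in Sg.
  have : h \notin ~: Sg by rewrite (cards0_eq (_ : #|~: Sg| = 0)) ?inE //; lia.
  by rewrite inE negbK.
exists rho; first by apply: inj_card_bij; rewrite ?cardH.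
have adj_rho h h' : adj h h' -> adj (rho h) (rho h').
  by case/g_adj => u [v [gu gv]]; rewrite (SgB h u _ gu) // (SgB h' v _ gv).
move=> h h'; apply/idP/idP; last exact: adj_rho.
(* Adjacent [rho h] and [rho h'] differ in colour, so one of them lies in a class of size [b]. Its
   degree in [G] equals the lower bound for degrees in [H], so no edge at it can be missing. *)
wlog hb : h h' / #|[set x | f x == f (rho h)]| = b.
  move=> IH hh'; case: (eqVneq (f (rho h)) i0) => [hi0|]; last first.
    by move/card_i => hb; apply: IH.
  rewrite adj_sym; apply: IH; last by rewrite adj_sym.
  by apply: card_i; move: hh'; rewrite fP hi0 eq_sym.
move=> hh'; apply: contraT => Nhh'; have := degH h; rewrite leqNgt => /negP[].
have := multipartite_class_card (rho h) fP; rewrite hb => deg_rho.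
have : degree h < degree (rho h); last by lia.
rewrite /degree -(card_imset _ rho_inj); apply/proper_card/properP; split.
  by apply/subsetP => _ /imsetP[t /[!inE] ht ->]; apply: adj_rho.
exists (rho h'); rewrite ?inE //; apply: contra Nhh'.
by rewrite mem_imset ?inE.
Qed.

Lemma branching_comp (G H H' : sgraph) (g : G -> option H)
    (g' : H -> option H') :
  branching g -> branching g' -> branching (fun u => obind g' (g u)).
Proof.
move=> [g_surj g_adj] [g'_surj g'_adj]; split=> [h|h h'].
  have [v gv] := g'_surj h; have [u gu] := g_surj v.
  by exists u; rewrite gu.
case/g'_adj=> v [v' [gv gv' /g_adj[u [u' [gu gu' uu']]]]].
by exists u, u'; rewrite gu gu'.
Qed.

Lemma branching_leq_card (G H : sgraph) (g : G -> option H) :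
  branching g -> #|H| <= #|G|.
Proof.
case=> /fin_all_exists[rho rhoK] _; apply: (leq_card rho) => h h' /(congr1 g).
by rewrite !rhoK => -[].
Qed.

(** With no vertex to spare, all branch sets are singletons and [rho] makes [H] a spanning subgraph
    of [G]. *)
Lemma branching_leq_min_degree (G H : sgraph) (g : G -> option H) :
  branching g -> #|G| <= #|H| -> min_degree H <= min_degree G.
Proof.
case=> /fin_all_exists[rho rhoK] g_adj leGH.
have rho_inj : injective rho by move=> h h' /(congr1 g); rewrite !rhoK => -[].
have [rho' _ rho'K] := inj_card_bij rho_inj leGH.
have gK u : g u = Some (rho' u) by rewrite -{1}(rho'K u) rhoK.
case def_k: (min_degree H) => [//|k].
have /min_degree_gtP degH : k < min_degree H by rewrite def_k.
apply/min_degree_gtP => u; apply: leq_trans (degH (rho' u)) _.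
rewrite /degree -(card_imset _ rho_inj); apply/subset_leq_card/subsetP.
move=> _ /imsetP[h + ->]; rewrite !inE => /g_adj[v [w [+ +]]].
by rewrite !gK => -[/(can_inj rho'K)-> [<-]]; rewrite rho'K.
Qed.

(** Phrased with [branching] so that it applies to minors of minors through [branching_comp]. *)
Lemma Kab_minimal (G : sgraph) a b p (a_ge1 : 0 < a) k :
    a <= b -> 2 <= p -> (p = 2 -> a = b) -> k.+1 = a + (p - 1) * b ->
    giso G (Kab b p a_ge1) ->
  k < min_degree G /\
  forall (H : sgraph) (g : G -> option H),
    branching g -> k < min_degree H -> giso H G.
Proof.
move=> ab p_ge2 p2 kE isoG; case: (isoG) => h bij_h hP.
pose f x := tag (h x).
have fP x y : adj x y = (f x != f y) by rewrite -hP.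
have card_class i : #|[set x | f x == i]| = nth 0 (a :: nseq p b) i.
  have h_inj := bij_inj bij_h; rewrite -(card_imset _ h_inj).
  have -> : h @: [set x | f x == i] = [set u | tag u == i].
    apply/setP => u; case: (bij_h) => g gK Kg; rewrite -[u]Kg mem_imset // !inE.
    by rewrite /f Kg.
  pose t (j : 'I_(nth 0 (a :: nseq p b) i)) : K_vertex (a :: nseq p b) :=
    @Tagged _ i (fun i => 'I_(nth 0 (a :: nseq p b) i)) j.
  have t_inj : injective t by move=> j l /eqP; rewrite eq_Tagged => /eqP.
  rewrite -[RHS]card_ord -(card_imset _ t_inj).
  apply: eq_card => -[j l]; rewrite inE /=; apply/eqP/imsetP => [ji|[m _ jm]];
    last exact: (congr1 tag jm).
  by subst j; exists l.
have card_b (i : 'I_(size (a :: nseq p b))) :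
    i != ord0 -> #|[set x | f x == i]| = b.
  rewrite card_class; case: i => [[//|i] /= i_lt] _.
  by move: i_lt; rewrite ltnS size_nseq nth_nseq => ->.
split.
  apply/min_degree_gtP => x; have := multipartite_class_card x fP.
  rewrite (giso_card isoG) card_Kab.
  have : #|[set y | f y == f x]| <= b.
    case: (eqVneq (f x) ord0) => [->|/card_b->//]; by rewrite card_class.
  have -> : p * b = (p - 1) * b + b by rewrite mulnBl mul1n subnK // leq_pmull; lia.
  by lia.
move=> H g gP /min_degree_gtP degH.
apply: (branching_min_degree (p := p) gP fP (card_class ord0) card_b) => //.
- by rewrite card_ord /= size_nseq.
- by move=> h0; rewrite -kE.
Qed.

Theorem theorem8p4 (k : nat) (k_ge1 : 1 <= k) (G : sgraph)
    (G_multipartite : complete_multipartite G) :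
  (minimal_forbidden (C k) G <-> minimal_forbidden (D k) G) /\
  (minimal_forbidden (D k) G <->
     exists (a b p : nat) (a_ge1 : 1 <= a),
       [/\ a <= b, 2 <= p, k + 1 = a + (p - 1) * b,
           giso G (Kab b p a_ge1) & (p = 2 -> a = b)]).
Proof.
set cond := exists a b p a_ge1, _.
(* Both (a) and (b) yield these hypotheses: connectivity equals minimum degree on [G] and never
   exceeds it on any graph. *)
have crit : k < min_degree G ->
    (forall H, proper_minor H G -> connectivity H <= k) -> cond.
  move=> /min_degree_gtP degG properG.
  exact: (critical_giso k_ge1 G_multipartite degG properG).
have c_of_a : minimal_forbidden (C k) G -> cond.
  case/(minimal_forbidden_gt
    (fun H => @giso_multipartite_connectivity G H G_multipartite)).
  by rewrite multipartite_connectivity //; apply: crit.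
have c_of_b : minimal_forbidden (D k) G -> cond.
  case/(minimal_forbidden_gt (fun H => @giso_min_degree H G)) => degG properG.
  apply: crit => // H /properG.
  exact: leq_trans (connectivity_leq_min_degree H).
have ab_of_c : cond -> minimal_forbidden (C k) G /\ minimal_forbidden (D k) G.
  case=> a [b [p [a_ge1 [ab p_ge2 kE isoG p2]]]]; rewrite addn1 in kE.
  have [degG properG] := Kab_minimal ab p_ge2 p2 kE isoG.
  (* A minor [H'] of [H] with minimum degree above [k] is isomorphic to [G], so [H] has no more
     vertices than [H'] and its minimum degree is at least that of [H']. Then [H] is isomorphic to
     [G] as well, against properness. *)
  have D_proper H : proper_minor H G -> D k H.
    case=> /minor_branching[g gP] NisoHG H' /minor_branching[g' g'P].
    rewrite leqNgt; apply/negP => degH'; apply: NisoHG.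
    apply: (properG _ g gP); apply: (leq_trans degH').
    apply: (branching_leq_min_degree g'P).
    apply: leq_trans (branching_leq_card gP) _.
    by rewrite (giso_card (properG _ _ (branching_comp gP g'P) degH')).
  split; split.
  - by move/(_ G (minor_refl G)); rewrite multipartite_connectivity // leqNgt degG.
  - move=> H /D_proper DH H' /DH.
    exact: leq_trans (connectivity_leq_min_degree H').
  - by move/(_ G (minor_refl G)); rewrite leqNgt degG.
  - exact: D_proper.
split; last by split=> [//|/ab_of_c[]].
by split=> [/c_of_a|/c_of_b] /ab_of_c[].
Qed.
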